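(* Let $Y$ be a pure $3$-dimensional simplicial complex, and let $\lambda^{\mathbb R}\colon V(Y)\to\mathbb Z_2^4$ be a mod $2$ characteristic map over $Y$. If $\Sigma(\lambda^{\mathbb R})$ is disjoint from some block $B_\alpha$ of the bad-block partition $\mathcal F(X(\mathbb Z_2^4))=\bigsqcup_{\alpha=1}^{168}B_\alpha$, then $\lambda^{\mathbb R}$ admits a lift. Equivalently, if $\Sigma(\lambda^{\mathbb R})$ meets fewer than $168$ blocks of this partition, then $\lambda^{\mathbb R}$ admits a lift.
   Context: $\mathbb Z_2=\mathbb Z/2\mathbb Z$. $X(\mathbb Z_2^4)$ is the simplicial complex whose vertices are the nonzero vectors of $\mathbb Z_2^4$ and whose simplices are the linearly independent subsets; its set of facets $\mathcal F(X(\mathbb Z_2^4))$ is the set of (unordered) bases of $\mathbb Z_2^4$, of which there are $840$. For a facet $\tau=\{u_1,u_2,u_3,u_4\}$ put $P(\tau)=\{\tau\}\cup\{\,\{u_i\}\cup\{u_j+u_i\mid j\ne i\}\mid i=1,2,3,4\}$, a set of $5$ facets. It is a known fact that the distinct sets among the $P(\tau)$, as $\tau$ runs over all facets, form a partition of $\mathcal F(X(\mathbb Z_2^4))$ into $168$ sets $B_1,\dots,B_{168}$ of size $5$; this is the bad-block partition and its members are its blocks. The standard bad block $B=B_1$ is the set of the bases whose $0$-$1$ representatives in $\mathbb Z^4$ have determinant of absolute value $3$; it equals $P(\{(0,0,1,1),(0,1,0,1),(1,0,0,1),(1,1,1,0)\})$, and every block $B_\alpha$ is mapped to $B$ by some element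 of $\mathrm{GL}(4,\mathbb Z_2)$. For a pure $3$-dimensional simplicial complex $Y$ with vertex set $V(Y)$, a mod $2$ characteristic map over $Y$ is a map $\lambda^{\mathbb R}\colon V(Y)\to\mathbb Z_2^4$ such that the images of the four vertices of every facet form a basis of $\mathbb Z_2^4$, and $\Sigma(\lambda^{\mathbb R})=\{\lambda^{\mathbb R}(\sigma)\mid\sigma\text{ a facet of }Y\}\subset\mathcal F(X(\mathbb Z_2^4))$. A lift of $\lambda^{\mathbb R}$ is a map $\lambda\colon V(Y)\to\mathbb Z^4$ such that the images of the four vertices of every facet form a $\mathbb Z$-basis of $\mathbb Z^4$ and $\lambda(v)\equiv\lambda^{\mathbb R}(v)\pmod 2$ for every vertex $v$. *)

(* Defs.v *)
From HB Require Import structures.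
From mathcomp Require Import all_boot all_order all_algebra finmap.
From mathcomp Require Import boolp.

Set Implicit Arguments.
Unset Strict Implicit.
Unset Printing Implicit Defensive.

Import GRing.Theory.
Local Open Scope ring_scope.

(* Abstract, possibly infinite, simplicial complex with vertex set the whole
   of V.  The empty set counts as a simplex of any nonempty complex. *)
Record simplicial_complex (V : choiceType) := SimplicialComplex {
  simplex : {fset V} -> Prop;
  simplex_vertex : forall v, simplex [fset v]%fset;
  simplex_sub : forall s t : {fset V}, (s `<=` t)%fset -> simplex t -> simplex s
}.

Section Complex.
Variables (V : choiceType) (Y : simplicial_complex V).

Definition facet (s : {fset V}) : Prop :=
  simplex Y s /\ forall t, simplex Y t -> (s `<=` t)%fset -> t = s.

Definition has_dim (d : nat) : Prop :=
  (exists2 s, simplex Y s & #|` s|%fset = d.+1) /\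
  (forall s, simplex Y s -> (#|` s|%fset <= d.+1)%N).

Definition pure_dim (d : nat) : Prop :=
  has_dim d /\ forall s, facet s -> #|` s|%fset = d.+1.

End Complex.

Notation Z2vec := 'rV['F_2]_4.
Notation Zvec := 'rV[int]_4.

Definition Z_basis (X : seq Zvec) : Prop :=
  forall w : Zvec, exists! c : {ffun 'I_(size X) -> int},
    w = \sum_(i < size X) c i *: X`_i.

(* The facets of X(Z_2^4), i.e. the unordered bases of Z_2^4. *)
Definition facetsX : {set {set Z2vec}} :=
  [set tau : {set Z2vec} | basis_of fullv (enum tau)].

Definition pivot (tau : {set Z2vec}) (u : Z2vec) : {set Z2vec} :=
  u |: [set v + u | v in tau :\ u].

(* The set P(tau) of five facets; bad_blocks keeps each distinct P(tau) once. *)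
Definition block_of (tau : {set Z2vec}) : {set {set Z2vec}} :=
  tau |: [set pivot tau u | u in tau].

Definition bad_blocks : {set {set {set Z2vec}}} :=
  [set block_of tau | tau in facetsX].

Section CharacteristicMap.
Variables (V : choiceType) (Y : simplicial_complex V).

(* A facet s is used as a duplicate-free list, so that its vertices are
   required to have distinct images. *)
Definition mod2_char_map (lamR : V -> Z2vec) : Prop :=
  forall s, facet Y s -> basis_of fullv [seq lamR v | v <- s].

Definition Sigma (lamR : V -> Z2vec) : {set {set Z2vec}} :=
  [set tau : {set Z2vec} |
    `[< exists2 s : {fset V}, facet Y s & tau = [set lamR (val v) | v : s] >]].

Definition is_lift (lamR : V -> Z2vec) (lam : V -> Zvec) : Prop :=
  (forall s, facet Y s -> Z_basis [seq lam v | v <- s]) /\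
  (forall v, map_mx intr (lam v) = lamR v).

End CharacteristicMap.

(* Main.v *)
Require Import Defs.
From HB Require Import structures.
From mathcomp Require Import all_boot all_order all_fingroup all_algebra finmap.
From mathcomp Require Import boolp.

Set Implicit Arguments.
Unset Strict Implicit.
Unset Printing Implicit Defensive.

Import GRing.Theory.
Local Open Scope ring_scope.

(** Write [F = 0 |: tau] for a basis [tau] of [Z_2^4].  The five points of [F]
    form an affine frame, and the members of [P(tau)] are the bases obtained by
    translating [F] so that one of its points becomes the origin, and then
    dropping the origin ([block_ofE]).  Two bases thus have the same block
    exactly when their frames are translates of one another, so the blocks are
    the classes of an equivalence relation on the bases
    ([bad_blocks_partition]).  Each class has five members: a translation is
    read off from the sum of the points of the frame, since 5 is odd
    ([card_block_of]).  As [|GL_4(2)| = 840 * 4!], there are 840 bases, hence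
    168 blocks.  This makes missing some block the same as meeting fewer than
    168 of them.

    For the lift, the natural candidate sends a vector to its 0-1
    representative.  A basis mod 2 gives a 0-1 matrix of odd determinant, and a
    0-1 matrix of order 4 has determinant at most 3 in absolute value, so the
    candidate only fails on bases of determinant 3 or -3.  The five points of a
    frame are vertices of the unit cube, the determinant is up to sign 4! times
    the volume of the simplex they span, and a translation mod 2 is a symmetry
    of the cube; the bases of determinant 3 or -3 are therefore a union of
    blocks.  They are in fact the single block of the basis
    [{0111, 1011, 1101, 1110}], which is a finite verification over the sets of
    four vertices of the cube ([det_lift01_bound]).

    If the missed block is that of another basis [tau], choose [g] in
    [GL_4(2)] carrying [tau] to this standard basis and an integral unimodular
    matrix [H] reducing to the inverse of [g] (it exists by an LUP
    decomposition, [unitmx_lift]).  Then sending [v] to the 0-1 representative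
    of [v g], multiplied by [H], reduces to [v] mod 2 and turns every basis
    outside the block of [tau] into a basis of [Z^4] ([lift_off_block]). *)

(** * Bases and invertible matrices *)

Definition rows_mx (R : Type) (m n : nat) (X : m.-tuple 'rV[R]_n) : 'M[R]_(m, n) :=
  \matrix_i tnth X i.

Lemma rows_mx_mul (R : pzSemiRingType) m n p (X : m.-tuple 'rV[R]_n)
    (A : 'M[R]_(n, p)) :
  rows_mx X *m A = rows_mx [tuple of [seq x *m A | x <- X]].
Proof. by apply/row_matrixP => i; rewrite row_mul !rowK tnth_map. Qed.

Lemma mul_rows_mx (R : pzSemiRingType) m n (c : 'rV[R]_m) (X : m.-tuple 'rV[R]_n) :
  c *m rows_mx X = \sum_i c 0 i *: X`_i.
Proof.
by rewrite mulmx_sum_row; apply: eq_bigr => i _; rewrite rowK (tnth_nth 0).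
Qed.

(** In dimension [n], a family of [n] vectors is a basis as soon as it is free,
    and freeness is the injectivity of [c |-> c *m rows_mx X]. *)
Lemma basis_of_rows_mx (F : fieldType) n (X : n.-tuple 'rV[F]_n) :
  basis_of fullv X = (rows_mx X \in unitmx).
Proof.
rewrite basisEfree subvf dimvf dim_matrix mul1r size_tuple leqnn !andbT.
rewrite -row_free_unit; apply/freeP/idP => [frX | /row_freeP[B XB1] k].
  apply: inj_row_free => c; rewrite mul_rows_mx => /frX c0.
  by apply/rowP => i; rewrite c0 mxE.
move=> sum0; have: (\row_i k i) *m rows_mx X = 0.
  by rewrite mul_rows_mx -[RHS]sum0; apply: eq_bigr => i _; rewrite mxE.
move=> /(congr1 (mulmx^~ B)); rewrite -mulmxA XB1 mulmx1 mul0mx => k0 i.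
by move/rowP/(_ i): k0; rewrite !mxE.
Qed.

Lemma Z_basis_rows_mx (X : 4.-tuple Zvec) : rows_mx X \in unitmx -> Z_basis X.
Proof.
case: X => -[|a [|b [|c [|d [|e X]]]]] //= Xsz uX w.
set M := rows_mx _ in uX.
have comb (k : 'I_4 -> int) :
    \sum_(i < 4) k i *: [:: a; b; c; d]`_i = (\row_i k i) *m M.
  by rewrite mul_rows_mx; apply: eq_bigr => i _; rewrite mxE.
exists [ffun i => (w *m invmx M) 0 i]; split=> [|k ->].
  rewrite (comb [ffun i => (w *m invmx M) 0 i]).
  rewrite -[LHS](mulmxKV uX); congr (_ *m _).
  by apply/rowP => i; rewrite [RHS]mxE ffunE.
apply/ffunP => i; rewrite ffunE [X in X *m _](comb k) mulmxK //.
by rewrite mxE.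
Qed.

(** * Integral lifts of matrices over the field with two elements *)

Definition lift01 m n (A : 'M['F_2]_(m, n)) : 'M[int]_(m, n) :=
  map_mx (fun x : 'F_2 => (x : nat)%:Z) A.

Lemma map_lift01 m n (A : 'M['F_2]_(m, n)) : map_mx intr (lift01 A) = A.
Proof. by apply/matrixP => i j; rewrite !mxE -[LHS]/((A i j : nat)%:R) natr_Zp. Qed.

Lemma F2_neq0 (x : 'F_2) : x != 0 -> x = 1.
Proof. by case: x => -[|[|m]] // lt_m2 _; apply: val_inj. Qed.

(** Reduction mod 2 commutes with determinants. *)
Lemma det_lift01_odd n (A : 'M['F_2]_n) :
  A \in unitmx -> odd `|\det (lift01 A)|.
Proof.
rewrite unitmxE -{1}(map_lift01 A) det_map_mx unitfE.
set d := \det _.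
rewrite -(rmorph0 intr) => dN.
apply: contraNT dN => ev.
have -> : d = (sgz d * (`|d|%N./2)%:Z) * 2.
  by rewrite -mulrA -PoszM muln2 even_halfK -?intEsg.
by rewrite rmorphM /= [2%:~R](_ : _ = 0) ?mulr0 //; apply: val_inj.
Qed.

(** [GL_n(Z)] maps onto [GL_n(2)]: in an LUP decomposition over the field with
    two elements both triangular factors have ones on the diagonal, so their
    0-1 representatives have determinant 1; the permutation factor is already
    integral. *)
Lemma unitmx_lift n (A : 'M['F_2]_n.+1) : A \in unitmx ->
  exists2 H : 'M[int]_n.+1, H \in unitmx & map_mx intr H = A.
Proof.
move=> uA; have := cormen_lup_correct A; have := cormen_lup_perm A.
have := @cormen_lup_lower _ _ A; have := @cormen_lup_upper _ _ A.
case: (cormen_lup A) => [[P L] U] /= Uup Llo /is_perm_mxP[s defP] PA.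
have uP : P \in unitmx by rewrite defP unitmx_perm.
have diagU i : U i i = 1.
  have : U \in unitmx.
    have : P *m A \in unitmx by rewrite unitmx_mul uP.
    by rewrite [_ *m _]PA unitmx_mul => /andP[].
  rewrite -unitmx_tr unitmxE det_trig; last first.
    by apply/is_trig_mxP => j k lt_jk; rewrite mxE Uup.
  by rewrite unitfE => /prodf_neq0/(_ i isT); rewrite mxE; apply: F2_neq0.
have uL : lift01 L \in unitmx.
  rewrite unitmxE det_trig; last first.
    by apply/is_trig_mxP => i j lt_ij; rewrite mxE Llo ?(ltnW lt_ij) // -val_eqE ltn_eqF.
  by rewrite big1 ?unitr1 // => i _; rewrite mxE Llo // eqxx.
have uU : lift01 U \in unitmx.
  rewrite -unitmx_tr unitmxE det_trig; last first.
    by apply/is_trig_mxP => i j lt_ij; rewrite !mxE Uup.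
  by rewrite big1 ?unitr1 // => i _; rewrite !mxE diagU.
exists (perm_mx s^-1%g *m lift01 L *m lift01 U).
  by rewrite !unitmx_mul unitmx_perm uL uU.
rewrite !map_mxM map_perm_mx !map_lift01 -mulmxA [L *m U](esym PA) defP mulmxA.
by rewrite -perm_mxM mulVg perm_mx1 mul1mx.
Qed.

(** * Blocks as translates of an affine frame *)

Lemma Z2_addvv (v : Z2vec) : v + v = 0.
Proof.
apply/rowP => i; rewrite !mxE.
by case: (v 0 i) => -[|[|m]] //= lt_m; apply: val_inj.
Qed.

Lemma Z2_addKv (u v : Z2vec) : v + u + u = v.
Proof. by rewrite -addrA Z2_addvv addr0. Qed.

Definition translate (F : {set Z2vec}) (u : Z2vec) : {set Z2vec} :=
  [set v + u | v in F].

(** The basis seen from the point [u] of the affine frame [0 |: tau] when that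
    point is taken as the origin. *)
Definition frame_at (tau : {set Z2vec}) (u : Z2vec) : {set Z2vec} :=
  translate (0 |: tau) u :\ 0.

Lemma mem_translate F u v : (v \in translate F u) = (v + u \in F).
Proof.
apply/imsetP/idP => [[x Fx ->]|Fvu]; first by rewrite Z2_addKv.
by exists (v + u); rewrite ?Z2_addKv.
Qed.

Lemma translateD F u w : translate (translate F u) w = translate F (u + w).
Proof. by apply/setP => v; rewrite !mem_translate -addrA (addrC w). Qed.

Lemma card_translate F u : #|translate F u| = #|F|.
Proof. exact/card_imset/addIr. Qed.

Lemma sum_translate F u : \sum_(v in translate F u) v = \sum_(v in F) v + u *+ #|F|.
Proof.
rewrite big_imset /=; last by move=> v w _ _ /addIr.
by rewrite big_split sumr_const.
Qed.

Lemma facetsXE (tau : {set Z2vec}) :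
  (tau \in facetsX) = (#|tau| == 4) && (fullv <= <<enum tau>>)%VS.
Proof.
rewrite inE basisEdim -cardE dimvf dim_matrix mul1r andbC eqn_leq -andbA.
case sp: (fullv <= _)%VS; rewrite ?andbF ?andbT //.
have := leq_trans (dimvS sp) (dim_span _).
by rewrite dimvf dim_matrix mul1r -cardE => ->; rewrite andbT.
Qed.

Lemma card_facet (tau : {set Z2vec}) : tau \in facetsX -> #|tau| = 4.
Proof. by rewrite facetsXE => /andP[/eqP]. Qed.

Lemma facet_notin0 (tau : {set Z2vec}) : tau \in facetsX -> 0 \notin tau.
Proof.
rewrite inE basisEfree => /andP[frX _]; rewrite -mem_enum.
by apply/negP => /(free_not0 frX); rewrite eqxx.
Qed.

Lemma card_frame (tau : {set Z2vec}) : tau \in facetsX -> #|0 |: tau| = 5.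
Proof. by move=> ftau; rewrite cardsU1 facet_notin0 ?card_facet. Qed.

Lemma frame_atK tau u : u \in 0 |: tau -> 0 |: frame_at tau u = translate (0 |: tau) u.
Proof. by move=> Fu; rewrite setD1K // mem_translate add0r. Qed.

(** [pivot tau u] is [frame_at tau u]: translating by [u] sends the origin to
    [u], sends [u] to the dropped origin, and any other [v] to [v + u].  The
    remaining member [tau] is [frame_at tau 0]. *)
Lemma block_ofE (tau : {set Z2vec}) : 0 \notin tau ->
  block_of tau = [set frame_at tau u | u in 0 |: tau].
Proof.
move=> tau0; rewrite /block_of imsetU1; congr (_ |: _).
  apply/setP => v; rewrite !inE mem_translate addr0 !inE.
  by case: (eqVneq v 0) => [->|]; rewrite //= (negPf tau0).
apply: eq_in_imset => u tau_u; apply/setP => v.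
have u0 : u != 0 by apply: contraNneq tau0 => <-.
rewrite /pivot -/(translate _ _) !inE !mem_translate !inE.
have -> : (v + u == u) = (v == 0) by rewrite -{2}[u]add0r (inj_eq (addIr _)).
have -> : (v + u == 0) = (v == u).
  by rewrite -(Z2_addvv u) (inj_eq (addIr _)).
case: (eqVneq v 0) => [->|v0] //=.
by rewrite eq_sym (negPf u0).
Qed.

(** Changing the base point preserves spanning, as [v = (v + u) + (0 + u)] is a
    sum of two points of the translated frame. *)
Lemma frame_at_facet tau u :
  tau \in facetsX -> u \in 0 |: tau -> frame_at tau u \in facetsX.
Proof.
move=> ftau Fu; rewrite facetsXE; apply/andP; split.
  have := cardsU1 0 (frame_at tau u).
  by rewrite frame_atK // card_translate card_frame // setD11 add1n => -[<-].
move: (ftau); rewrite facetsXE => /andP[_ /subv_trans]; apply.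
have mem_sp v : v \in translate (0 |: tau) u -> v \in <<enum (frame_at tau u)>>%VS.
  rewrite -frame_atK // => /setU1P[->|]; first exact: mem0v.
  by rewrite -mem_enum => /memv_span.
apply/span_subvP => v; rewrite mem_enum => tau_v.
have -> : v = (v + u) + (0 + u) by rewrite add0r Z2_addKv.
by rewrite rpredD // mem_sp // mem_translate Z2_addKv !inE ?tau_v ?orbT ?eqxx.
Qed.

(** Frames that are translates of one another have the same translates. *)
Lemma block_of_frame_at tau u : tau \in facetsX -> u \in 0 |: tau ->
  block_of (frame_at tau u) = block_of tau.
Proof.
move=> ftau Fu.
rewrite !block_ofE ?facet_notin0 ?frame_at_facet // frame_atK //.
have E w : frame_at (frame_at tau u) w = frame_at tau (u + w).
  by rewrite /frame_at frame_atK // translateD.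
apply/setP => sig; apply/imsetP/imsetP => -[w Fw ->].
  by exists (w + u); rewrite -?mem_translate // E addrC.
by exists (w + u); rewrite ?E ?mem_translate ?Z2_addKv // [w + u]addrC addrA Z2_addvv add0r.
Qed.

Lemma mem_block_of sig tau : sig \in facetsX -> tau \in facetsX ->
  (tau \in block_of sig) = (block_of sig == block_of tau).
Proof.
move=> fsig ftau; apply/idP/eqP => [|->]; last exact: setU11.
rewrite {1}block_ofE ?facet_notin0 // => /imsetP[u Fu ->].
by rewrite block_of_frame_at.
Qed.

Lemma block_of_sub tau : tau \in facetsX -> block_of tau \subset facetsX.
Proof.
move=> ftau; rewrite block_ofE ?facet_notin0 //.
by apply/subsetP => _ /imsetP[u Fu ->]; apply: frame_at_facet.
Qed.

(** The five members are distinct: translating a frame by [u] adds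
    [5 u = u] to the sum of its points, so the translated frame determines
    [u]. *)
Lemma card_block_of tau : tau \in facetsX -> #|block_of tau| = 5.
Proof.
move=> ftau; rewrite block_ofE ?facet_notin0 // card_in_imset ?card_frame //.
move=> u w Fu Fw /(congr1 (fun A => \sum_(v in 0 |: A) v)).
rewrite !frame_atK // !sum_translate card_frame // => /addrI.
have odd5 x : x *+ 5 = x :> Z2vec.
  by rewrite (mulrnDr x 1 4) (mulrnA x 2 2) (mulr2n x) Z2_addvv mul0rn addr0.
by rewrite !odd5.
Qed.

(** By [mem_block_of], the blocks are the fibres of [block_of]. *)
Lemma bad_blocks_partition : partition bad_blocks facetsX.
Proof.
suff -> : bad_blocks = preim_partition block_of facetsX by apply: preim_partitionP.
apply: eq_in_imset => tau ftau; apply/setP => sig; rewrite [RHS]inE.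
case fsig: (sig \in facetsX); first exact: mem_block_of.
by apply: contraFF fsig; apply/subsetP/block_of_sub.
Qed.

(** * The number of bases *)

Lemma basis_of_set (T : seq Z2vec) :
  size T = 4 -> [set x in T] \in facetsX -> basis_of fullv T.
Proof.
move=> szT fT; move: (fT); rewrite inE (@perm_basis _ _ _ T) //.
apply: uniq_perm; rewrite ?enum_uniq //; last by move=> x; rewrite mem_enum inE.
by apply/card_uniqP; rewrite szT -(card_facet fT); apply: eq_card => x; rewrite inE.
Qed.

Lemma facet_of_basis (T : seq Z2vec) : basis_of fullv T -> [set x in T] \in facetsX.
Proof.
move=> bT; rewrite inE (@perm_basis _ _ _ T) //.
apply: uniq_perm; rewrite ?enum_uniq ?free_uniq ?(basis_free bT) //.
by move=> x; rewrite mem_enum inE.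
Qed.

Lemma card_unitmx4 : #|[set M : 'M['F_2]_4 | M \in unitmx]| = (840 * 24)%N.
Proof.
have := @card_GL 'F_2 4 isT; rewrite card_Fp // => E.
transitivity #|'GL_4['F_2]%g|; last by rewrite E; do 4!rewrite big_ltn //; rewrite big_geq.
by rewrite cardsT card_sub cardsE.
Qed.

(** An invertible matrix is an ordering of the basis formed by its rows, and
    every basis has [4!] orderings. *)
Lemma card_facetsX : #|facetsX| = 840.
Proof.
pose rows (M : 'M['F_2]_4) := [set x in [tuple row i M | i < 4]].
have mxK (M : 'M['F_2]_4) : rows_mx [tuple row i M | i < 4] = M.
  by apply/row_matrixP => i; rewrite rowK tnth_mktuple.
apply/eqP; rewrite -(eqn_pmul2r (isT : 0 < 24)%N); apply/eqP.
transitivity #|[set M : 'M['F_2]_4 | M \in unitmx]|; last by rewrite card_unitmx4.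
rewrite -sum_nat_const -sum1_card.
rewrite (partition_big rows (mem facetsX)) => [|M] /=; last first.
  by rewrite inE -{1}[M]mxK -basis_of_rows_mx => /facet_of_basis.
apply: eq_bigr => tau ftau; rewrite sum1dep_card.
(* The fibre over [tau] is the set of injections of ['I_4] into [tau]: four
   distinct elements of a basis of size 4 exhaust it. *)
transitivity (#|tau| ^_ #|'I_4|)%N; first by rewrite card_ord card_facet.
rewrite -card_inj_ffuns_on.
pose mx (f : {ffun 'I_4 -> Z2vec}) : 'M['F_2]_4 := \matrix_i f i.
rewrite -(card_imset _ (_ : injective mx)); last first.
  by move=> f g fg; apply/ffunP => i; rewrite -[f i]rowK -[g i]rowK -/(mx _) fg.
apply: eq_card => M; rewrite [RHS]inE; apply/imsetP/idP => [[f]|].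
  rewrite inE => /andP[/ffun_onP tau_f /injectiveP inj_f] ->{M}.
  have Ef : rows (mx f) = tau.
    apply/eqP; rewrite eqEcard card_facet //; apply/andP; split.
      apply/subsetP => x; rewrite inE => /tnthP[i ->].
      by rewrite tnth_mktuple rowK tau_f.
    rewrite -[4]card_ord -(card_imset _ inj_f) subset_leq_card //.
    apply/subsetP => _ /imsetP[i _ ->]; rewrite inE; apply/tnthP.
    by exists i; rewrite tnth_mktuple rowK.
  rewrite Ef eqxx andbT inE -[mx f]mxK -basis_of_rows_mx.
  by apply: basis_of_set; rewrite ?size_tuple // [X in X \in _]Ef.
rewrite inE => /andP[uM /eqP Etau]; exists [ffun i => row i M].
  rewrite inE; apply/andP; split.
    apply/ffun_onP => i; rewrite ffunE -Etau inE.
    by apply/tnthP; exists i; rewrite tnth_mktuple.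
  move: uM; rewrite -{1}[M]mxK -basis_of_rows_mx => /basis_free/free_uniq.
  move=> /tuple_uniqP inj; apply/injectiveP => i j; rewrite !ffunE => eq_ij.
  by apply: inj; rewrite !tnth_mktuple.
by apply/row_matrixP => i; rewrite rowK ffunE.
Qed.

Lemma card_bad_blocks : #|bad_blocks| = 168.
Proof.
apply/eqP; rewrite -(eqn_pmul2r (isT : 0 < 5)%N).
rewrite -(card_uniform_partition _ bad_blocks_partition).
  by rewrite card_facetsX.
by move=> _ /imsetP[tau ftau ->]; apply: card_block_of.
Qed.

(** * Determinants of 0-1 matrices *)

(** Row expansion along the first row, written with structural recursion only so
    that it evaluates; matrices and big operators are locked. *)
Fixpoint laplace (n : nat) (f : nat -> nat -> int) : int :=
  if n isn't m.+1 then 1 else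
  foldr (fun j s => (-1) ^+ j * f 0 j * laplace m (fun i k => f i.+1 (bump j k)) + s)
    0 (iota 0 n).

Lemma laplace_det n (f : nat -> nat -> int) :
  \det (\matrix_(i < n, j < n) f i j) = laplace n f.
Proof.
elim: n f => [|n IHn] f; first by rewrite det_mx00.
transitivity (\sum_(0 <= j < n.+1)
    (-1) ^+ j * f 0 j * laplace n (fun i k => f i.+1 (bump j k))).
  rewrite big_mkord (expand_det_row _ ord0); apply: eq_bigr => j _.
  rewrite mxE /cofactor add0n mulrA (mulrC (f _ _)) -IHn; congr (_ * \det _).
  by apply/matrixP => i k; rewrite !mxE.
by rewrite unlock.
Qed.

Definition xor_bits (b c : seq bool) : seq bool :=
  mkseq (fun i => nth false b i (+) nth false c i) 4.

Definition cube : seq (seq bool) :=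
  iter 4 (fun s => [seq b :: v | b <- [:: false; true], v <- s]) [:: [::]].

(** The affine frame of the basis formed by the complements of the unit vectors;
    that basis has determinant -3. *)
Definition frame_bits : seq (seq bool) :=
  [:: [:: false; false; false; false]; [:: false; true; true; true];
      [:: true; false; true; true]; [:: true; true; false; true];
      [:: true; true; true; false]].

(** Containment in the translated frame suffices to single out a member of the
    block: the rows of a basis are nonzero and distinct, so they fill the four
    nonzero points. *)
Definition in_bad_block (rs : seq (seq bool)) : bool :=
  has (fun t => all (mem [seq xor_bits f t | f <- frame_bits]) rs) frame_bits.

Definition bits_det (rs : seq (seq bool)) : int :=
  laplace 4 (fun i j => (nth false (nth [::] rs i) j : nat)%:Z).

(** Enumerating the rows up to order leaves 1820 determinants to evaluate,
    instead of [2 ^ 16]. *)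
Fixpoint combinations (T : Type) (k : nat) (s : seq T) : seq (seq T) :=
  match k, s with
  | 0, _ => [:: [::]]
  | _.+1, [::] => [::]
  | k'.+1, x :: s' =>
      [seq x :: t | t <- combinations k' s'] ++ combinations k s'
  end.

Lemma subseq_combinations (T : eqType) (s t : seq T) :
  subseq t s -> t \in combinations (size t) s.
Proof.
elim: s t => [|x s IHs] [|y t] //=.
rewrite mem_cat; case: eqP => [->|_] sub_ts; apply/orP; last by right; apply: IHs.
by left; rewrite mem_map => [|? ? []//]; apply: IHs.
Qed.

(** Verified by evaluation.  The only other values are 3 and -3, Hadamard's
    bound for 0-1 matrices of order 4, and the rows attaining it form a single
    block. *)
Lemma bits_det_bound :
  all (fun rs => (`|bits_det rs| <= 2)%N || in_bad_block rs) (combinations 4 cube).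
Proof. by vm_compute. Qed.

Definition bits (v : Z2vec) : seq bool := [seq v 0 i != 0 | i <- enum 'I_4].

Definition vec (b : seq bool) : Z2vec := \row_j (nth false b j : nat)%:R.

Lemma nth_bits v (j : 'I_4) : nth false (bits v) j = (v 0 j != 0).
Proof. by rewrite (nth_map ord0) ?size_enum_ord // nth_ord_enum. Qed.

Lemma bitsK : cancel bits vec.
Proof.
move=> v; apply/rowP => j; rewrite mxE nth_bits.
by case: eqP => [->|/eqP/F2_neq0->].
Qed.

Lemma bits_cube v : bits v \in cube.
Proof.
rewrite /bits enum_ordSl enum_ordSl enum_ordSl enum_ordSl enum_ord0 /=.
by do 4!case: (_ != 0).
Qed.

Lemma vec_xor b c : vec (xor_bits b c) = vec b + vec c.
Proof.
apply/rowP => j; rewrite !mxE nth_mkseq //.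
by case: (nth _ b _); case: (nth _ c _) => //; apply: val_inj.
Qed.

(** Both sides of the alternative ignore the order of the rows (a permutation
    changes the sign of the determinant only), so the rows may be listed in
    their order in [cube] and [bits_det_bound] applies. *)
Lemma det_lift01_bound (X : 4.-tuple Z2vec) : uniq X ->
  (`|\det (lift01 (rows_mx X))| <= 2)%N || in_bad_block [seq bits v | v <- X].
Proof.
move=> uX; set B := [tuple of [seq bits v | v <- X]].
pose S := [seq b <- cube | b \in B].
have SB : perm_eq S B.
  apply: uniq_perm; first by rewrite filter_uniq.
    by rewrite map_inj_uniq //; apply: can_inj bitsK.
  move=> b; rewrite mem_filter; case Bb: (b \in B) => //=.
  by case/mapP: Bb => v _ ->; rewrite bits_cube.
have -> : in_bad_block B = in_bad_block S.
  by apply: eq_has => t; apply/esym/perm_all.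
have /(allP bits_det_bound) : S \in combinations 4 cube.
  by rewrite -(size_tuple B) -(perm_size SB) subseq_combinations ?filter_subseq.
suff -> : `|bits_det S|%N = `|\det (lift01 (rows_mx X))|%N by [].
have /tuple_permP[p ->] := SB.
rewrite /bits_det -laplace_det -[RHS](abszMsign (perm.odd_perm p)) -det_perm -det_mulmx.
rewrite -row_permE; congr (`|\det _|%N); apply/matrixP => i j; rewrite !mxE.
rewrite -tnth_nth tnth_mktuple tnth_map nth_bits.
by case: eqP => [->|/eqP/F2_neq0->].
Qed.

(** * Moving a block to the standard one *)

(** Its rows are the basis whose frame is [frame_bits]. *)
Definition std_frame_mx : 'M['F_2]_4 := const_mx 1 + 1%:M.

Lemma std_frame_mx_unit : std_frame_mx \in unitmx.
Proof.
(* With [J] the all-ones matrix, [(J + 1)^2 = J^2 + 2 J + 1 = 1] mod 2. *)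
pose J : 'M['F_2]_4 := const_mx 1.
suff /mulmx1_unit[] : std_frame_mx *m std_frame_mx = 1%:M by [].
have JJ : J *m J = 0.
  by apply/matrixP => i j; rewrite !mxE !big_ord_recl big_ord0 !mxE; apply: val_inj.
have J2 : J + J = 0 by apply/matrixP => i j; rewrite !mxE; apply: val_inj.
by rewrite mulmxDl mulmxDr mul1mx mulmx1 JJ add0r addrA J2 add0r.
Qed.

Lemma vec_frame_bits b : b \in frame_bits ->
  vec b = 0 \/ exists i, vec b = row i std_frame_mx.
Proof.
have rowE b' (k : nat) (lt_k : (k < 4)%N) :
    all (fun j => nth false b' j == (j != k)) (iota 0 4) ->
    exists i, vec b' = row i std_frame_mx.
  move=> /allP Eb'; exists (Ordinal lt_k); apply/rowP => j; rewrite !mxE.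
  have /Eb'/eqP-> : (j : nat) \in iota 0 4 by rewrite mem_iota /=.
  rewrite -val_eqE /= eq_sym; case: eqP => _ /=; last by rewrite addr0.
  exact: val_inj.
rewrite !inE => /or4P[|||/orP[]] /eqP->; [left|right..].
- by apply/rowP => j; rewrite !mxE; case: j => -[|[|[|[|]]]].
- exact: (@rowE _ 0).
- exact: (@rowE _ 1).
- exact: (@rowE _ 2).
- exact: (@rowE _ 3).
Qed.

(** The linear map [g] carries the frame of [tau] onto the standard one, hence
    translates of the former onto translates of the latter.  So if the images of
    [X] lie in [std + t] with [t = u *m g], then [X] lies in the frame of [tau]
    translated by [u]; as it avoids 0 and has four elements, it is
    [frame_at tau u]. *)
Lemma bad_mem_block (tau : {set Z2vec}) (g : 'M['F_2]_4) (X : 4.-tuple Z2vec) :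
  tau \in facetsX -> g \in unitmx ->
  (forall i, exists2 u, u \in tau & row i std_frame_mx = u *m g) ->
  basis_of fullv X -> in_bad_block [seq bits (v *m g) | v <- X] ->
  [set x in X] \in block_of tau.
Proof.
move=> ftau ug tau_g bX /hasP[t Ft /allP badX].
have frame_g b : b \in frame_bits -> exists2 u, u \in 0 |: tau & vec b = u *m g.
  case/vec_frame_bits => [->|[i ->]]; first by exists 0; rewrite ?setU11 ?mul0mx.
  by case: (tau_g i) => u tau_u ->; exists u; rewrite // setU1r.
case: (frame_g t Ft) => u Fu Et.
rewrite block_ofE ?facet_notin0 //; apply/imsetP; exists u => //.
have fX := facet_of_basis bX.
apply/eqP; rewrite eqEcard !card_facet ?frame_at_facet // leqnn andbT.
apply/subsetP => v Xv; rewrite in_setD1; apply/andP; split.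
  by apply: contraNneq (facet_notin0 fX) => <-.
have /badX/mapP[b Fb] : bits (v *m g) \in [seq bits (v *m g) | v <- X].
  by apply/mapP; exists v; rewrite // -[_ \in _]in_set.
case: (frame_g b Fb) => w Fw Eb /(congr1 vec).
rewrite bitsK vec_xor Eb Et -mulmxDl => /(congr1 (mulmx^~ (invmx g))).
by rewrite !mulmxK // mem_translate => ->; rewrite Z2_addKv.
Qed.

(** The section is [v |-> lift01 (v *m g) *m H], where [g] takes [tau] to the
    standard basis and [H] is an integral lift of its inverse.  Off the block,
    the determinant of the 0-1 representatives is odd and at most 2 in absolute
    value, so it is a unit. *)
Lemma lift_off_block (tau : {set Z2vec}) : tau \in facetsX ->
  exists2 s : Z2vec -> Zvec, forall v, map_mx intr (s v) = v &
    forall X : 4.-tuple Z2vec, basis_of fullv X -> [set x in X] \notin block_of tau ->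
      rows_mx [tuple of [seq s x | x <- X]] \in unitmx.
Proof.
move=> ftau; have sz : size (enum tau) == 4 by rewrite -cardE card_facet.
have [T rowT uT] : exists2 T : 'M['F_2]_4,
    forall i, row i T = tnth (Tuple sz) i & T \in unitmx.
  exists (rows_mx (Tuple sz)) => [i|]; first exact: rowK.
  by rewrite -basis_of_rows_mx; move: ftau; rewrite inE.
pose g := invmx T *m std_frame_mx.
have ug : g \in unitmx by rewrite unitmx_mul unitmx_inv uT std_frame_mx_unit.
have [H uH Hg] := unitmx_lift (etrans (unitmx_inv g) ug).
exists (fun v => lift01 (v *m g) *m H) => [v|X bX NX].
  by rewrite map_mxM map_lift01 Hg mulmxK.
pose Xg := [tuple of [seq x *m g | x <- X]].
have -> : rows_mx [tuple of [seq lift01 (x *m g) *m H | x <- X]]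
        = lift01 (rows_mx Xg) *m H.
  by apply/row_matrixP => i; rewrite row_mul /lift01 -map_row !rowK !tnth_map.
rewrite unitmx_mul uH andbT.
have uXg : rows_mx Xg \in unitmx.
  by rewrite -rows_mx_mul unitmx_mul ug -basis_of_rows_mx bX.
have := det_lift01_odd uXg.
have /det_lift01_bound/orP[|bad] : uniq Xg.
- by apply: free_uniq; apply: (@basis_free _ _ fullv); rewrite basis_of_rows_mx uXg.
- rewrite unitmxE; case: (\det _) => -[|[|[|m]]] //=.
case/negP: NX; apply: (bad_mem_block ftau ug) => //; last by rewrite -map_comp in bad.
move=> i; exists (tnth (Tuple sz) i); first by rewrite -mem_enum mem_tnth.
by rewrite -rowT -row_mul mulKVmx.
Qed.

(** * Lifts of characteristic maps *)

Lemma facet_image_Sigma (V : choiceType) (Y : simplicial_complex V) (lamR : V -> Z2vec)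
    (s : {fset V}) : facet Y s -> [set x in [seq lamR v | v <- s]] \in Sigma Y lamR.
Proof.
move=> fs; rewrite inE; apply/asboolP; exists s => //.
apply/setP => x; rewrite inE; apply/mapP/imsetP => [[v sv ->]|[v _ ->]].
  by exists [` sv]%fset.
by exists (val v) => //; apply: valP.
Qed.

Lemma lift_of_missed_block (V : choiceType) (Y : simplicial_complex V) (lamR : V -> Z2vec) :
  pure_dim Y 3 -> mod2_char_map Y lamR ->
  (exists2 B, B \in bad_blocks & [disjoint Sigma Y lamR & B]) ->
  exists lam : V -> Zvec, is_lift Y lamR lam.
Proof.
move=> [_ pureY] charY [_ /imsetP[tau ftau ->] /disjointFr missB].
have [s s_mod2 s_basis] := lift_off_block ftau.
exists (s \o lamR); split=> [t ft | v]; last exact: s_mod2.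
have sz : size [seq lamR v | v <- t] == 4 by rewrite size_map pureY.
rewrite (map_comp s lamR);
suff /Z_basis_rows_mx : rows_mx [tuple of [seq s x | x <- Tuple sz]] \in unitmx by [].
by apply: s_basis; rewrite ?charY // missB ?facet_image_Sigma.
Qed.

Lemma card_setId_ltn (T : finType) (A : {set T}) (p : pred T) :
  (#|[set x in A | ~~ p x]| < #|A|)%N <->
  exists2 x, x \in A & p x.
Proof.
have sub : [set x in A | ~~ p x] \subset A by apply/subsetP => x; rewrite inE => /andP[].
split=> [lt_A | [x Ax px]].
  have /properP[_ [x Ax]] : [set x in A | ~~ p x] \proper A by rewrite properEcard sub.
  by rewrite inE Ax negbK; exists x.
by apply: proper_card; apply/properP; split=> //; exists x; rewrite // inE px andbF.
Qed.

Theorem lemma2p2 (V : choiceType) (Y : simplicial_complex V)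
    (lamR : V -> Z2vec) :
  pure_dim Y 3 ->
  mod2_char_map Y lamR ->
  [/\ (exists2 B, B \in bad_blocks & [disjoint Sigma Y lamR & B]) ->
        exists lam : V -> Zvec, is_lift Y lamR lam,
      (#|[set B in bad_blocks | ~~ [disjoint Sigma Y lamR & B]]| < 168)%N ->
        exists lam : V -> Zvec, is_lift Y lamR lam
    & (exists2 B, B \in bad_blocks & [disjoint Sigma Y lamR & B]) <->
        (#|[set B in bad_blocks | ~~ [disjoint Sigma Y lamR & B]]| < 168)%N].
Proof.
move=> pureY charY.
have missP := card_setId_ltn bad_blocks (fun B => [disjoint Sigma Y lamR & B]).
rewrite card_bad_blocks in missP.
split; first exact: lift_of_missed_block.
  by move/missP; apply: lift_of_missed_block.
exact: iff_sym.
Qed.
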